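(* A chain mixed graph (CMG) $G$ is maximal if and only if $G$ does not contain any primitive inducing walk between non-adjacent nodes.
   Context: Graphs: a graph $G=(V,E)$ has a finite node set $V$ and edges of four possible types: lines (solid, undirected), arrows ($i\to j$), arcs ($i\leftrightarrow j$), and dotted lines (undirected). There are no loops, but multiple edges between the same two nodes are allowed. Two nodes are adjacent if they are the endpoints of some edge. A walk is a list $\langle i_0,e_1,i_1,\dots,e_n,i_n\rangle$ of nodes and edges with $e_m$ having endpoints $i_{m-1},i_m$; nodes and edges may repeat. Sections and separation: a section of a walk is a maximal subwalk consisting only of solid lines (possibly a single node); a walk decomposes uniquely into sections. A section is an endpoint section if it contains an endpoint (first or last position) of the walk, otherwise an inner section. An inner section is a collider section if, of the two edges of the walk adjacent to it, both have an arrowhead pointing to the section, or one has an arrowhead pointing to the section and the other is a dotted line. All other sections, including endpoint sections, are non-collider sections. A walk is connecting given $C$ if all its collider sections intersect $C$ and all its non-collider sections are disjoint from $C$. For pairwise disjoint $A,B,C\subseteq V$, $A\perp B\,|\,C$ means there is no connecting walk given $C$ between a node of $A$ and a node of $B$. The independence model induced by $G$ is $\mathcal{J}(G)=\{\langle A,B\,|\,C\rangle : A\perp B\,|\,C\}$. CMGs and anteriors: a walk from $i$ to $j$ is semi-directed if it has at least one arrow, no arcs, and every arrow on it points in the direction from $i$ to $j$. A CMG is a graph without dotted lines and without semi-directed cycles (a cycle is a closed walk with at least two edges and no repeated node except its coinciding first and last nodes). In a CMG, a walk from $i$ to $j$ is anterior if it is semi-directed from $i$ to $j$ or consists only of lines.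 For $i\neq j$, $i$ is an anterior of $j$ if there is an anterior walk from $i$ to $j$; $\mathrm{ant}(j)$ is the set of anteriors of $j$, $\mathrm{ant}(A)=\bigcup_{j\in A}\mathrm{ant}(j)\setminus A$, and $\mathrm{Ant}(A)=A\cup\mathrm{ant}(A)$. Maximality: $G$ is maximal if adding an edge between any two non-adjacent nodes of $G$ changes the independence model $\mathcal{J}(G)$. Primitive inducing walk: a walk $\omega$ between $i$ and $j$ ($i\neq j$) is primitive inducing if it is a single edge between $i$ and $j$, or $\omega=\langle i,q_1,\dots,q_p,j\rangle$ where (i) all inner sections of $\omega$ are collider sections; (ii) the endpoint sections of $\omega$ are single elements; (iii) $q_n\in\mathrm{Ant}(\{i,j\})$ for every $1\le n\le p$. *)

(* Defs.v *)
From mathcomp Require Import all_boot.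
Set Implicit Arguments.
Unset Strict Implicit.
Unset Printing Implicit Defensive.

Inductive edge_kind := Line | Arrow | Arc | Dotted.

(* Edges are primitive objects, so multiple edges (possibly of the same kind)
   are allowed. The order of the two endpoints only matters for an arrow, which
   points from [src] to [tgt]. *)
Record graph (V : finType) := Graph {
  edge : Type;
  kind : edge -> edge_kind;
  src : edge -> V;
  tgt : edge -> V;
  no_loop : forall e, src e != tgt e }.
Arguments Graph {V}.

Section Graphs.
Variables (V : finType) (G : graph V).
Implicit Types (e f : edge G) (i j x y : V) (A B C : {set V}).

Definition is_line e := if kind e is Line then true else false.
Definition is_arrow e := if kind e is Arrow then true else false.
Definition is_arc e := if kind e is Arc then true else false.
Definition is_dotted e := if kind e is Dotted then true else false.

Definition joins e x y : bool :=
  (src e == x) && (tgt e == y) || (src e == y) && (tgt e == x).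

Definition adjacent i j : Prop := exists e, joins e i j.

Definition head_at e x : bool := is_arc e || is_arrow e && (tgt e == x).

(* The walk <i_0, e_1, i_1, ..., e_n, i_n> is represented by its first node
   i_0 and the list of steps [:: (e_1, i_1); ...; (e_n, i_n)]. *)
Notation steps := (seq (edge G * V)).

Fixpoint is_walk i (s : steps) : bool :=
  if s is (e, x) :: s' then joins e i x && is_walk x s' else true.

Definition later_nodes (s : steps) : seq V := unzip2 s.
Definition walk_end i (s : steps) : V := last i (later_nodes s).
Definition walk_nodes i (s : steps) : seq V := i :: later_nodes s.

Definition walk_between i j (s : steps) : Prop := is_walk i s /\ walk_end i s = j.

Definition inner_nodes i (s : steps) : seq V := behead (belast i (later_nodes s)).

Definition all_lines (s : steps) : bool := all (fun st => is_line st.1) s.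

(* A section is given by the decomposition p ++ q ++ r of the list of steps in
   which q is a maximal run of lines; q = [::] is a section with a single node. *)
Definition is_section (s p q r : steps) : Prop :=
  [/\ s = p ++ q ++ r, all_lines q,
      forall p' e x, p = rcons p' (e, x) -> ~~ is_line e
    & forall e x r', r = (e, x) :: r' -> ~~ is_line e].

Definition section_nodes i (p q : steps) : seq V := walk_nodes (walk_end i p) q.

Definition endpoint_section (p r : steps) : Prop := p = [::] \/ r = [::].

(* [e] enters the section at its first node [x], [f] leaves it at its last
   node [y]. *)
Definition collider_section i (p q r : steps) : Prop :=
  exists p' e x f z r',
    [/\ p = rcons p' (e, x), r = (f, z) :: r'
      & let y := walk_end x q in
        [|| head_at e x && head_at f y,
            head_at e x && is_dotted f
          | is_dotted e && head_at f y]].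

Definition connecting C i (s : steps) : Prop :=
  forall p q r, is_section s p q r ->
    (collider_section i p q r -> exists2 x, x \in section_nodes i p q & x \in C)
    /\ (~ collider_section i p q r ->
        forall x, x \in section_nodes i p q -> x \notin C).

Definition separated A B C : Prop :=
  ~ exists i j s, [/\ i \in A, j \in B, walk_between i j s & connecting C i s].

Definition independence_model A B C : Prop :=
  [/\ [disjoint A & B], [disjoint A & C], [disjoint B & C] & separated A B C].

(* As there are no loops, an arrow e_m points in the direction of the walk
   exactly when its target is i_m. *)
Definition semi_directed (s : steps) : bool :=
  [&& has (fun st => is_arrow st.1) s,
      all (fun st => ~~ is_arc st.1) s
    & all (fun st => is_arrow st.1 ==> (tgt st.1 == st.2)) s].

Definition is_cycle i (s : steps) : Prop :=
  [/\ walk_between i i s, 2 <= size s & uniq (later_nodes s)].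

Definition CMG : Prop :=
  (forall e, ~~ is_dotted e)
  /\ ~ exists i s, is_cycle i s /\ semi_directed s.

Definition anterior_walk i j (s : steps) : Prop :=
  walk_between i j s /\ (semi_directed s || all_lines s).

Definition anterior i j : Prop := i != j /\ exists s, anterior_walk i j s.

Definition ant A i : Prop := (exists2 j, j \in A & anterior i j) /\ i \notin A.

Definition Ant A i : Prop := i \in A \/ ant A i.

Definition primitive_inducing i j (s : steps) : Prop :=
  [/\ i != j, walk_between i j s
    & size s = 1 \/
      [/\ forall p q r, is_section s p q r ->
            ~ endpoint_section p r -> collider_section i p q r,
          forall p q r, is_section s p q r ->
            endpoint_section p r -> size (section_nodes i p q) = 1
        & forall x, x \in inner_nodes i s -> Ant [set i; j] x]].

Lemma add_edge_no_loop i j (nij : i != j) (o : option (edge G)) :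
  (if o is Some e then src e else i) != (if o is Some e then tgt e else j).
Proof. by case: o => [e|//]; apply: no_loop. Qed.

Definition add_edge i j (nij : i != j) (t : edge_kind) : graph V :=
  @Graph V (option (edge G))
    (fun o => if o is Some e then kind e else t)
    (fun o => if o is Some e then src e else i)
    (fun o => if o is Some e then tgt e else j)
    (add_edge_no_loop nij).

End Graphs.

Definition same_model (V : finType) (G H : graph V) : Prop :=
  forall A B C : {set V}, independence_model G A B C <-> independence_model H A B C.

(* Since (i, j) ranges over ordered pairs, both orientations of a new arrow are
   covered. *)
Definition maximal (V : finType) (G : graph V) : Prop :=
  forall (i j : V) (nij : i != j) (t : edge_kind),
    ~ adjacent G i j -> ~ same_model G (add_edge G nij t).

(* Main.v *)
(* Whether a walk is connecting given C can be read off by an automaton whose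
   state is the current node, whether the current section was entered through an
   arrowhead, and whether it has already met C.  Sections become invisible this
   way, and connecting walks become paths in a finite relation.

   If G has no inducing walk between non-adjacent i and j, then i and j are
   separated by C = ant({i, j}): all nodes of a connecting walk would lie in
   Ant({i, j}), so its non-collider sections would be {i} or {j}, and the part
   from the last {i} before a {j} to that {j} would be primitive inducing.

   Conversely, given a primitive inducing walk between i and j, add an arc if
   both its end edges have heads at i and j; otherwise acyclicity leaves exactly
   one tail, say at i, with i anterior to j, and we add the arrow i -> j.  A
   passage through the new edge can be imitated in G by following the inducing
   walk: a collider section that is anterior to C is made active by a detour into
   C, and a node not anterior to C is anterior to i or to j by a walk avoiding C,
   which serves as a shortcut. *)
Require Import Defs.
From mathcomp Require Import all_boot.
From mathcomp Require Import boolp.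

Set Implicit Arguments.
Unset Strict Implicit.
Unset Printing Implicit Defensive.

(** * Edges, anterior walks and inducing walks as finite relations *)

Section Relations.
Variables (V : finType) (G : graph V).
Implicit Types (e : edge G) (x y z i j : V) (h c : bool) (C : {set V}).

Definition no_dotted := forall e : edge G, ~~ is_dotted e.

Definition lin : rel V := fun x y => `[< exists2 e : edge G, is_line e & joins e x y >].

(* hx and hy are the marks of the edge at x and at y: true for a head, false for
   a tail. *)
Definition ed hx hy : rel V := fun x y =>
  `[< exists e : edge G, [/\ ~~ is_line e, joins e x y, head_at e x = hx & head_at e y = hy] >].

Lemma joinsC e x y : joins e x y = joins e y x.
Proof. by rewrite /joins orbC. Qed.

Lemma joins_neq e x y : joins e x y -> x != y.
Proof.
have := no_loop e; rewrite /joins => nl /orP[]/andP[/eqP <- /eqP <-] //.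
by rewrite eq_sym.
Qed.

Lemma lin_sym : symmetric lin.
Proof.
by move=> x y; apply/asboolP/asboolP => -[e le je]; exists e => //; rewrite joinsC.
Qed.

Lemma ed_sym hx hy x y : ed hx hy x y = ed hy hx y x.
Proof.
by apply/asboolP/asboolP => -[e [ne je e1 e2]]; exists e; split => //; rewrite joinsC.
Qed.

Lemma lin_adjacent x y : lin x y -> adjacent G x y.
Proof. by move/asboolP => [e _ je]; exists e. Qed.

Lemma ed_adjacent hx hy x y : ed hx hy x y -> adjacent G x y.
Proof. by move/asboolP => [e [_ je _ _]]; exists e. Qed.

Lemma adjacent_sym x y : adjacent G x y -> adjacent G y x.
Proof. by move=> [e je]; exists e; rewrite joinsC. Qed.

Lemma ed_head hx hy x y : no_dotted -> ed hx hy x y -> hx || hy.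
Proof.
move=> nd /asboolP [e [nl je <- <-]]; move: nl (nd e) je.
rewrite /head_at /is_line /is_dotted /is_arc /is_arrow /joins.
by case: (kind e) => //= _ _ /orP[]/andP[_ ->]; rewrite ?orbT.
Qed.

(** Tail at [x] and head at [y] means an arrow from [x] to [y]; without dotted lines, the paths of
    this relation are the anterior walks. *)
Definition ant_step : rel V := fun x y => lin x y || ed false true x y.
Definition toward (C : {set V}) x := [exists (c | c \in C), connect ant_step x c].
(** A section can be prolonged along lines, so this decides whether a section through [x] can be
    made to meet [C]. *)
Definition line_meets C x := [exists (c | c \in C), connect lin x c].

(* The state (x, h, c): h tells whether the current section was entered through
   a head (not at the start of the walk), c whether it has already met C. *)
Definition step C : rel (V * bool * bool) := fun s t =>
  let: (x, h, c) := s in let: (y, h', c') := t in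
  [&& lin x y, h' == h & c' == c || (y \in C)]
  || [exists hx, ed hx h' x y && (c == h && hx)] && (c' == (y \in C)).

Lemma step_lin C x y h c : lin x y -> step C (x, h, c) (y, h, c || (y \in C)).
Proof. by move=> l; rewrite /step l !eqxx. Qed.

(** The condition [c = h && hx] makes the section being left active: it has met [C] exactly if it is
    entered and left through heads. *)
Lemma step_ed C hx hy x y h c :
  ed hx hy x y -> c = h && hx -> step C (x, h, c) (y, hy, y \in C).
Proof.
move=> l ->; apply/orP; right; rewrite eqxx andbT.
by apply/existsP; exists hx; rewrite l eqxx.
Qed.

Variant step_spec C x h c : V -> bool -> bool -> Prop :=
| StepLin y of lin x y : step_spec C x h c y h (c || (y \in C))
| StepEd y hx hy of ed hx hy x y & c = h && hx : step_spec C x h c y hy (y \in C).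

Lemma stepP C x h c y h' c' :
  step C (x, h, c) (y, h', c') -> step_spec C x h c y h' c'.
Proof.
case/orP => [/and3P[l /eqP-> /eqP->]|/andP[/existsP[hx /andP[l /eqP cE]] /eqP->]].
  exact: StepLin.
exact: StepEd l cE.
Qed.

Lemma toward_mono C x y : connect ant_step x y -> toward C y -> toward C x.
Proof.
move=> xy /existsP[c /andP[cC yc]]; apply/existsP; exists c.
by rewrite cC (connect_trans xy yc).
Qed.

Lemma lin_ant x y : lin x y -> connect ant_step x y.
Proof. by move=> l; apply: connect1; rewrite /ant_step l. Qed.

Lemma ed_ant x y : ed false true x y -> connect ant_step x y.
Proof. by move=> l; apply: connect1; rewrite /ant_step l orbT. Qed.

Lemma toward_lin C x y : lin x y -> toward C x = toward C y.
Proof.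
move=> l; apply/idP/idP; apply: toward_mono; apply: lin_ant => //.
by rewrite lin_sym.
Qed.

Lemma line_meets_lin C x y : lin x y -> line_meets C x = line_meets C y.
Proof.
move=> l; have cs := sym_connect_sym lin_sym.
apply: eq_existsb => c; congr (_ && _).
by apply: same_connect (connect1 l) c.
Qed.

Lemma mem_line_meets C x : x \in C -> line_meets C x.
Proof. by move=> xC; apply/existsP; exists x; rewrite xC connect0. Qed.

Lemma line_meets_toward C x : line_meets C x -> toward C x.
Proof.
case/existsP => c /andP[cC xc]; apply/existsP; exists c; rewrite cC /=.
by apply: connect_sub xc => y z; apply: lin_ant.
Qed.

Lemma line_meets_notin C x : ~~ line_meets C x -> (x \in C) = false.
Proof. by apply: contraNF; apply: mem_line_meets. Qed.

Lemma toward_notin C x : ~~ toward C x -> (x \in C) = false.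
Proof. by apply: contraNF => /mem_line_meets/line_meets_toward. Qed.

Definition ant2 i j x := connect ant_step x i || connect ant_step x j.

Lemma ant2C i j x : ant2 i j x = ant2 j i x.
Proof. exact: orbC. Qed.

Lemma ant2_mono i j x y : connect ant_step x y -> ant2 i j y -> ant2 i j x.
Proof.
by rewrite /ant2 => xy /orP[] h; rewrite (connect_trans xy h) ?orbT.
Qed.

(** Only lines and arcs occur strictly between the end edges, since every inner section is a
    collider section. *)
Definition ind_step i j : rel V := fun x y =>
  [&& lin x y || ed true true x y, ant2 i j x & ant2 i j y].

(* The relational form of a primitive inducing walk with at least two edges;
   h1 and h2 are the marks of its end edges at i and j. *)
Definition inducing i j h1 h2 := exists q q',
  [/\ ed h1 true i q, ant2 i j q && ant2 i j q',
      connect (ind_step i j) q q' & ed true h2 q' j].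

Lemma inducing_sym i j h1 h2 : inducing i j h1 h2 -> inducing j i h2 h1.
Proof.
move=> [q [q' [e1 a c e2]]]; exists q', q; split.
- by rewrite ed_sym.
- by rewrite andbC ![ant2 j i _]ant2C.
- rewrite (@eq_connect _ (ind_step j i) (ind_step i j)); last first.
    by move=> x y; rewrite /ind_step !(ant2C i).
  rewrite sym_connect_sym // => x y.
  by rewrite /ind_step lin_sym ed_sym [ant2 i j x && _]andbC.
- by rewrite ed_sym.
Qed.

(** * Reachability from a fixed state, and imitation of a new edge *)

Section Reach.
Variables (C : {set V}) (s0 : V * bool * bool).

Definition reach x h c := connect (step C) s0 (x, h, c).

Lemma reach_lin x y h c : lin x y -> reach x h c -> reach y h (c || (y \in C)).
Proof. by move=> l r; apply: connect_trans r (connect1 (step_lin _ _ _ l)). Qed.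

Lemma reach_ed hx hy x y h : ed hx hy x y -> reach x h (h && hx) -> reach y hy (y \in C).
Proof. by move=> l r; apply: connect_trans r (connect1 (step_ed _ l _)). Qed.

(** [tail_exit] and [head_exit] are the ways to satisfy the exit condition of [step_ed]. As [s0] is
    arbitrary, a true flag alone does not show that the line component meets [C]; [head_exit]
    records this. *)
Definition tail_exit x := exists h, reach x h false.
Definition head_exit x := line_meets C x && reach x true true \/ reach x false false.
(** A head exit whose form is fixed by the line component of [x], so that it can be carried along
    lines. *)
Definition collide x := if line_meets C x then reach x true true else reach x false false.

Lemma collide_head_exit x : collide x -> head_exit x.
Proof. by rewrite /collide /head_exit; case: ifP => _ r; [left|right]. Qed.

Lemma head_exit_ed hy x y : head_exit x -> ed true hy x y -> reach y hy (y \in C).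
Proof. by move=> [/andP[_ r]|r] l; apply: reach_ed l r. Qed.

Lemma tail_exit_ed hy x y : tail_exit x -> ed false hy x y -> reach y hy (y \in C).
Proof. by move=> [h r] l; apply: (@reach_ed _ _ _ _ h l); rewrite andbF. Qed.

(** Lines do not end a section: one walks to [y], where the flag becomes true, and back to [x],
    where it stays true. *)
Lemma reach_line x y : connect lin x y -> y \in C ->
  reach x true (x \in C) -> reach x true true.
Proof.
move=> xy yC r.
have up u v : connect lin u v -> forall c, reach u true c -> exists c', reach v true c'.
  case/connectP => p; elim: p u => [|w p IH] u /=; first by move=> _ -> c; exists c.
  by case/andP=> l pp lst c /(reach_lin l) ru; apply: IH ru.
have keep u v : connect lin u v -> reach u true true -> reach v true true.
  case/connectP => p; elim: p u => [|w p IH] u /=; first by move=> _ ->.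
  by case/andP=> l pp lst /(reach_lin l) ru; apply: IH ru.
apply: (keep y); first by rewrite (sym_connect_sym lin_sym).
(* The arrival at [y] sets the flag, so the last line is split off; on an empty path the flag is
   true from the start. *)
case/connectP: xy yC r => p; case/lastP: p => [|p w] /=; first by move=> _ -> ->.
rewrite rcons_path last_rcons => /andP[pp l] -> wC r.
have [|c' r'] := up x (last x p) _ _ r; first by apply/connectP; exists p.
by have := reach_lin l r'; rewrite wC orbT.
Qed.

(* Walking down an anterior walk into C and back turns an arrowhead entry into
   a tail entry. *)
Lemma detour x h : toward C x -> ~~ line_meets C x -> reach x h false ->
  reach x false false.
Proof.
case/existsP => c /andP[cC /connectP[p pp lst]]; move: cC; rewrite {c}lst.
elim: p x h pp => [|z p IH] x h /=; first by move=> _ xC; rewrite mem_line_meets.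
case/andP=> st pp lC nx r.
have xC := line_meets_notin nx.
case/orP: st => l.
  have nz : ~~ line_meets C z by rewrite -(line_meets_lin C l).
  have zC := line_meets_notin nz.
  have := reach_lin l r; rewrite zC => /(IH _ _ pp lC nz) r'.
  by move: l; rewrite lin_sym => /reach_lin/(_ r'); rewrite xC.
have rz : reach z true (z \in C) by apply: tail_exit_ed l; exists h.
suff ez : head_exit z.
  by move: l; rewrite ed_sym => /(head_exit_ed ez); rewrite xC.
(* Either [z] lies in a collider section made to meet [C], or the induction hypothesis turns its
   head entry into a tail entry. *)
have [nz|nz] := boolP (line_meets C z).
  left; case/existsP: (nz) => c /andP[cC zc]; rewrite nz.
  exact: reach_line zc cC rz.
right; apply: (IH z true pp lC nz).
by rewrite line_meets_notin in rz.
Qed.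

Lemma enter_collide x : reach x true (x \in C) -> toward C x -> collide x.
Proof.
rewrite /collide => r t; case: ifPn => nx.
  by case/existsP: nx => c /andP[cC xc]; apply: reach_line xc cC r.
by apply: (@detour x true) => //; rewrite line_meets_notin in r.
Qed.

(** Going forward along lines and arrows leaves sections through tails only, so none of them is a
    collider section, and no node met is in [C], as [x] would then be toward [C]. *)
Lemma tail_exit_ant x y : connect ant_step x y -> ~~ toward C x ->
  tail_exit x -> tail_exit y /\ ~~ toward C y.
Proof.
case/connectP=> p pp ->; elim: p x pp => [|z p IH] x /=; first by [].
case/andP=> st pp nx ex.
have nz : ~~ toward C z.
  by apply: contra nx; apply: toward_mono; apply: connect1.
have zC := toward_notin nz.
apply: IH => //; case/orP: st => l.
  by case: ex => h /(reach_lin l); rewrite zC; exists h.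
by exists true; rewrite -zC; apply: tail_exit_ed l.
Qed.

(** Traversed backwards, an anterior walk enters every new section through a tail, so no collider
    section arises. *)
Lemma reach_up x y : connect ant_step y x -> ~~ toward C y ->
  reach x false false -> reach y false false.
Proof.
case/connectP=> p pp ->; elim: p y pp => [|z p IH] y /=; first by [].
case/andP=> st pp ny r.
have nz : ~~ toward C z.
  by apply: contra ny; apply: toward_mono; apply: connect1.
have yC := toward_notin ny.
have {}r := IH z pp nz r.
case/orP: st => l.
  by rewrite lin_sym in l; have := reach_lin l r; rewrite yC.
by rewrite ed_sym in l; have := reach_ed (h := false) l r; rewrite yC.
Qed.

(* While walking from i along the inducing walk, a node outside toward C is
   either anterior to j, and then we leave for j at once, or anterior to i, and
   then it can be reached directly from i. *)
Lemma inducing_reach i j h2 q q' :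
  ant2 i j q -> connect (ind_step i j) q q' -> ed true h2 q' j ->
  (~~ toward C i -> reach i false false) -> reach q true (q \in C) ->
  (tail_exit j /\ ~~ toward C j) \/ reach j h2 (j \in C).
Proof.
move=> aq cq e2 Hi rq.
set D := tail_exit j /\ ~~ toward C j.
(* Along a line [I] persists because [toward C] and [line_meets C] are constant there; along an arc
   it is rebuilt by [enter]. *)
pose I x := D \/ (if toward C x then collide x else reach x false false).
have up x : ~~ toward C x -> connect ant_step x i -> reach x false false.
  move=> nx xi; have ni : ~~ toward C i by apply: contra nx; apply: toward_mono.
  exact: reach_up xi nx (Hi ni).
have enter x : ant2 i j x -> reach x true (x \in C) -> I x.
  move=> ax rx; rewrite /I; case: ifPn => tx; first by right; apply: enter_collide.
  case/orP: ax => ax; first by right; apply: up.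
  by left; apply: (tail_exit_ant ax tx); exists true; rewrite -(toward_notin tx).
have exit x : I x -> D \/ head_exit x.
  case=> [|]; first by left.
  by case: ifP => _ r; right; [apply: collide_head_exit | right].
have Iq' : I q'.
  case/connectP: cq => p pp ->.
  elim: p q pp {aq rq} (enter _ aq rq) => [|y p IH] x //= /andP[/and3P[l ax ay] pp] Ix.
  apply: IH => //; case/orP: l => l; last first.
    by case: (exit _ Ix) => [|/head_exit_ed/(_ l)]; [left | apply: enter].
  case: Ix => [|r]; first by left.
  right; rewrite -(toward_lin C l); case: ifP r => tx; last first.
    move=> /(reach_lin l); rewrite toward_notin // -(toward_lin C l); by rewrite tx.
  rewrite /collide -(line_meets_lin C l); case: ifPn => lx /(reach_lin l) //.
  by rewrite line_meets_notin // -(line_meets_lin C l).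
by case: (exit _ Iq') => [|/head_exit_ed/(_ e2)]; [left | right].
Qed.

(* What reach can achieve in G at a node which a walk of the enlarged graph
   reaches in state (x, h, c). *)
Definition simulates x h c : Prop :=
  match h, c with
  | false, false => tail_exit x /\ head_exit x
  | true, false => tail_exit x /\ (toward C x -> collide x)
  | true, true => line_meets C x && reach x true true
  | false, true => True
  end.

Lemma simulates_tail x h : simulates x h false -> tail_exit x.
Proof. by case: h => -[]. Qed.

Lemma simulates_head x h : simulates x h h -> head_exit x.
Proof. by case: h => [|[]] //= ?; left. Qed.

Lemma reach_simulates x h : reach x h (x \in C) -> simulates x h (x \in C).
Proof.
have [xC|xC] := boolP (x \in C); case: h => //= r.
- by rewrite r mem_line_meets.
- split; first by exists true.
  by apply: enter_collide; rewrite (negbTE xC).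
- by split; [exists false | right].
Qed.

(** If a line leads from state [(true, false)] into [C], then [x] is toward [C] and the conditional
    clause supplies the flag. A tail-entered section that has met [C] can neither be left nor end a
    connecting walk, so nothing is asked of it. *)
Lemma simulates_lin x y h c : lin x y -> simulates x h c -> simulates y h (c || (y \in C)).
Proof.
move=> l.
have tl : y \in C = false -> tail_exit x -> tail_exit y.
  by move=> yC [h' /(reach_lin l)]; rewrite yC; exists h'.
case: h c => [] [] //=.
- by rewrite -(line_meets_lin C l) => /andP[-> /(reach_lin l)].
- case=> tx cx; case yC: (y \in C) => /=.
    have lx : line_meets C x by rewrite (line_meets_lin C l) mem_line_meets.
    move: (cx (line_meets_toward lx)); rewrite /collide lx -(line_meets_lin C l) lx.
    by move/(reach_lin l).
  split; first exact: tl.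
  rewrite -(toward_lin C l) => /cx; rewrite /collide -(line_meets_lin C l).
  by case: ifP => _ /(reach_lin l); rewrite ?yC.
- case=> tx hx; case yC: (y \in C) => //=; split; first exact: tl.
  rewrite /head_exit -(line_meets_lin C l); case: hx => [/andP[->]|] /(reach_lin l).
    by left.
  by rewrite yC; right.
Qed.

Lemma simulates_ed hx hy x y h : ed hx hy x y -> simulates x h (h && hx) ->
  simulates y hy (y \in C).
Proof.
move=> l s; apply: reach_simulates; case: hx l s => l.
  by rewrite andbT => /simulates_head/head_exit_ed/(_ l).
by rewrite andbF => /simulates_tail/tail_exit_ed/(_ l).
Qed.

Lemma simulates_enter x : tail_exit x /\ ~~ toward C x -> simulates x true (x \in C).
Proof.
case=> tx nx; rewrite (toward_notin nx).
by split=> // t; rewrite t in nx.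
Qed.

Lemma head_exit_notin x : head_exit x -> ~~ toward C x -> reach x false false.
Proof. by case=> // /andP[/line_meets_toward ->]. Qed.

Lemma simulates_arc i j h : inducing i j true true -> simulates i h h ->
  simulates j true (j \in C).
Proof.
move=> [q [q' [e1 /andP[aq _] cq e2]]] /simulates_head hi.
have [||/simulates_enter|/reach_simulates] // := inducing_reach aq cq e2.
  exact: head_exit_notin.
exact: head_exit_ed hi e1.
Qed.

(** If [i] is not toward [C], the anterior walk to [j] replaces the arrow; otherwise the condition
    on [i] in [inducing_reach] is vacuous and the inducing walk is followed. *)
Lemma simulates_arrow i j h : connect ant_step i j -> inducing i j false true ->
  simulates i h false -> simulates j true (j \in C).
Proof.
move=> ij [q [q' [e1 /andP[aq _] cq e2]]] /simulates_tail ti.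
have [toi|ni] := boolP (toward C i); last first.
  by apply: simulates_enter; apply: tail_exit_ant ti.
have [||/simulates_enter|/reach_simulates] // := inducing_reach aq cq e2.
  by rewrite toi.
exact: tail_exit_ed ti e1.
Qed.

Lemma simulates_arrow_back i j h : connect ant_step i j -> inducing i j false true ->
  simulates j h h -> simulates i false (i \in C).
Proof.
move=> ij /inducing_sym [q [q' [e1 /andP[aq _] cq e2]]] /simulates_head hj.
apply: reach_simulates; have [toi|ni] := boolP (toward C i); last first.
  rewrite (toward_notin ni).
  have nj : ~~ toward C j by apply: contra ni; apply: toward_mono.
  exact: reach_up ij ni (head_exit_notin hj nj).
have [|||] // := inducing_reach aq cq e2; last by case=> _; rewrite toi.
  exact: head_exit_notin.
exact: head_exit_ed hj e1.
Qed.

End Reach.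

(** * Separating non-adjacent nodes by their anteriors *)

Section Inducing.
Variables (i j : V) (C : {set V}).
Hypothesis nd : no_dotted.
Hypothesis nadj : ~ adjacent G i j.
Hypothesis CE : C = [set x | ant2 i j x & x \notin [set i; j]].

Lemma head_entry_ant2 p x c : (c -> line_meets C x) ->
  path (step C) (x, true, c) p -> (last (x, true, c) p).1.1 = j -> ant2 i j x.
Proof.
elim: p x c => [|[[y h'] c'] p IH] x c cx /=.
  by move=> _ ->; rewrite /ant2 connect0 orbT.
case/andP=> /stepP [{}y l|{}y hx hy l cE] pp lst.
  apply: (ant2_mono (lin_ant l)); apply: IH pp lst.
  by case/orP => [/cx|/mem_line_meets]; rewrite ?(line_meets_lin C l).
case: hx l cE => l cE; last first.
  case: hy l pp lst => l pp lst; last by have := ed_head nd l.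
  apply: (ant2_mono (ed_ant l)); apply: IH pp lst; exact: mem_line_meets.
have /existsP[z /andP[zC xz]] : line_meets C x by apply: cx; rewrite cE.
have : ant2 i j z by move: zC; rewrite CE inE => /andP[].
by apply: ant2_mono; apply: connect_sub xz => u v; apply: lin_ant.
Qed.

Lemma connecting_inducing h : i != j ->
  connect (step C) (i, false, false) (j, h, false) ->
  exists h1 h2, inducing i j h1 h2.
Proof.
move=> nij /connectP[p0 pp0 lst0]; apply: contrapT => nI.
have {}nI h1 h2 : ~ inducing i j h1 h2 by move=> I; apply: nI; exists h1, h2.
(* An initial part of an inducing walk, from [i] to [x]. *)
pose onto x := exists h1 q,
  [/\ ed h1 true i q, ant2 i j q, ant2 i j x & connect (ind_step i j) q x].
(* A false flag forces [x = i]; the flag is false at the end of the walk, whence [j = i]. *)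
suff main p x h' c : path (step C) (x, h', c) p -> last (x, h', c) p = (j, h, false) ->
    ant2 i j x -> (c = false -> x = i) -> (h' -> onto x) -> j = i.
  move/eqP: nij; apply; apply/esym; apply: (main p0 i false false) => //.
  by rewrite /ant2 connect0.
elim: p x h' c => [|[[y h''] c'] p IH] x h' c /=; first by move=> _ [-> _ ->] _ /(_ erefl).
case/andP=> st pp lst ax ci hx0.
have ay : ant2 i j y.
  case/stepP: st pp lst => [{}y l _ _|{}y hx [] l _ pp lst].
  - by apply: ant2_mono ax; apply: lin_ant; rewrite lin_sym.
  - by apply: (head_entry_ant2 (@mem_line_meets C y) pp); rewrite lst.
  - case: hx l (ed_head nd l) => // l _.
    by apply: ant2_mono ax; apply: ed_ant; rewrite ed_sym.
apply: (IH _ _ _ pp lst) => // {IH pp lst}.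
(* Being in Ant({i, j}) but not in [C], the node [y] is [i] or [j]; if it were [j], an inducing walk
   would be complete or [i] and [j] adjacent. *)
- case/stepP: st ay => [{}y l|{}y hx hy l cE] ay yC.
    move/norP: (negbT yC) => [/negbTE/ci xi].
    rewrite CE inE ay !inE negbK => /orP[/eqP //|/eqP yj].
    by move/lin_adjacent: l; rewrite xi yj.
  move/negbT: yC; rewrite CE inE ay !inE negbK => /orP[/eqP //|/eqP yj].
  case: c cE ci => [/esym/andP[hT hxT] _|_ xi].
    have [h1 [q [e1 aq _ cq]]] := hx0 hT; case: (nI h1 hy).
    by exists q, x; rewrite aq ax; split=> //; rewrite -hxT -yj.
  by move/ed_adjacent: l; rewrite xi // yj.
- case/stepP: st ay => [{}y l|{}y hx hy l cE] ay hT.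
    have [h1 [q [e1 aq _ cq]]] := hx0 hT; exists h1, q; split=> //.
    by apply: connect_trans cq (connect1 _); rewrite /ind_step l ax ay.
  (* A true flag means that a collider section is left, and the partial inducing walk is extended; a
     false one means [x = i], and a new one starts. *)
  rewrite hT in l; case: c cE ci => [/esym/andP[h'T hxT] _|_ xi].
    have [h1 [q [e1 aq _ cq]]] := hx0 h'T; exists h1, q; split=> //.
    by apply: connect_trans cq (connect1 _); rewrite /ind_step -[X in ed X]hxT l ax ay orbT.
  by rewrite (xi erefl) in l; exists hx, y; split.
Qed.

End Inducing.
End Relations.

(** * Translation between sections of walks and relations *)

Section Sections.
Variables (V : finType) (G : graph V).
Implicit Types (e f : edge G) (x y z i j : V) (C : {set V}) (en ex : option bool).
Implicit Types (s p q r : seq (edge G * V)) (ns : seq V).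

(** The mark [None] stands for an end of the walk, so endpoint sections are those with a mark
    [None]. *)
Definition entry p := if p is st :: p' then
  let st' := last st p' in Some (head_at st'.1 st'.2) else None.
Definition exit x r := if r is (f, _) :: _ then Some (head_at f x) else None.

Lemma entry_rcons p e x : entry (rcons p (e, x)) = Some (head_at e x).
Proof. by case: p => [|st p] //=; rewrite last_rcons. Qed.

Lemma walk_end_rcons i p e x : walk_end i (rcons p (e, x)) = x.
Proof. by rewrite /walk_end /later_nodes /unzip2 map_rcons last_rcons. Qed.

Lemma collider_sectionP i p q r : no_dotted G ->
  collider_section i p q r <->
  entry p = Some true /\ exit (walk_end (walk_end i p) q) r = Some true.
Proof.
move=> nd; split.
  move=> [p' [e [x [f [z [r' [-> -> ]]]]]]] /=.
  rewrite entry_rcons walk_end_rcons (negbTE (nd e)) (negbTE (nd f)) andbF !orbF.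
  by case/andP=> -> ->.
case: r => [|[f z] r]; case/lastP: p => [|p [e x]] [] //.
rewrite entry_rcons walk_end_rcons /= => -[ex] [fx].
by exists p, e, x, f, z, r; split=> //=; rewrite ex fx.
Qed.

Section Traversal.
Variable Q : option bool -> seq V -> option bool -> Prop.

(* Checks Q, as a property of the entry mark, the nodes and the exit mark, on
   every section of a walk of which the current section has nodes ns so far. *)
Fixpoint sections_from en ns x s : Prop :=
  if s is (e, y) :: s' then
    if is_line e then sections_from en (rcons ns y) y s'
    else Q en ns (Some (head_at e x)) /\ sections_from (Some (head_at e y)) [:: y] y s'
  else Q en ns None.

Lemma sections_from_rcons en ns x p e y s : ~~ is_line e ->
  sections_from en ns x (rcons p (e, y) ++ s) ->
  sections_from (Some (head_at e y)) [:: y] y s.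
Proof.
move=> ne; elim: p en ns x => [|[f z] p IH] en ns x /=.
  by rewrite (negbTE ne) => -[].
by case: ifP => _; [apply: IH | case=> _; apply: IH].
Qed.

Lemma sections_from_lines en ns x q r : all_lines q ->
  sections_from en ns x (q ++ r) ->
  sections_from en (ns ++ later_nodes q) (walk_end x q) r.
Proof.
elim: q ns x => [|[f z] q IH] ns x /=; first by rewrite cats0.
by case/andP=> -> lq /(IH _ _ lq); rewrite cat_rcons.
Qed.

Lemma sectionsP i s :
  (forall p q r, is_section s p q r ->
     Q (entry p) (section_nodes i p q) (exit (walk_end (walk_end i p) q) r))
  <-> sections_from None [:: i] i s.
Proof.
split=> [|S p q r [sE lq ep er]].
  (* Generalized to a walk already traversed along [p] and then along the part [q] of the current
     section. *)
  have gen p q : all_lines q -> (forall p' e x, p = rcons p' (e, x) -> ~~ is_line e) ->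
    (forall p' q' r, is_section (p ++ q ++ s) p' q' r ->
      Q (entry p') (section_nodes i p' q') (exit (walk_end (walk_end i p') q') r)) ->
    sections_from (entry p) (section_nodes i p q) (walk_end (walk_end i p) q) s.
    elim: s p q => [|[e y] s IH] p q lq pe H /=; first by apply: (H p q [::]).
    case: ifP => le.
      have := IH p (rcons q (e, y)).
      rewrite walk_end_rcons /section_nodes /walk_nodes /later_nodes /unzip2 map_rcons /=.
      apply=> //; first by rewrite /all_lines all_rcons /= le.
      by rewrite cat_rcons.
    split; first by apply: (H p q ((e, y) :: s)); split=> // f z r [<- _ _]; rewrite le.
    have := IH (rcons (p ++ q) (e, y)) [::].
    rewrite entry_rcons /section_nodes walk_end_rcons /=; apply => //.
      by move=> p' f x /rcons_inj [_ <- _]; rewrite le.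
    by rewrite cat_rcons -catA.
  by move=> H; apply: (gen [::] [::]) => // -[].
have {S} : sections_from (entry p) [:: walk_end i p] (walk_end i p) (q ++ r).
  case/lastP: p sE ep => [|p [e y]] sE ep; first by rewrite -[q ++ r]/([::] ++ q ++ r) -sE.
  rewrite sE in S; rewrite entry_rcons walk_end_rcons.
  by apply: sections_from_rcons S; apply: ep.
move/(sections_from_lines lq); case: r er {sE} => [|[f z] r] er //=.
by rewrite (negbTE (er _ _ _ erefl)) => -[].
Qed.

End Traversal.

Definition connecting_section C en ns ex : Prop :=
  has (mem C) ns = (en == Some true) && (ex == Some true).

Lemma connectingP C i s : no_dotted G ->
  connecting C i s <-> sections_from (connecting_section C) None [:: i] i s.
Proof.
move=> nd; apply: iff_trans (sectionsP _ _ _).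
split=> H p q r /H; rewrite /connecting_section.
  case=> H1 H2; case: eqP => [en|en]; rewrite ?andTb ?andFb; last first.
    apply/negbTE/hasPn => x /H2; apply => /(collider_sectionP _ _ _ _ nd) -[] //.
  case: eqP => [ex|ex].
    by apply/hasP; apply: H1; apply/collider_sectionP.
  by apply/negbTE/hasPn => x /H2; apply => /(collider_sectionP _ _ _ _ nd) -[].
move=> E; split=> [/(collider_sectionP _ _ _ _ nd) [en ex]|nc].
  by move: E; rewrite en ex => /hasP.
apply/hasPn; rewrite [has _ _]E; apply/negP => /andP[/eqP en /eqP ex].
by apply: nc; apply/collider_sectionP.
Qed.

(** The start of the walk counts as a tail entry, and the final flag is false because the last
    section is not a collider section. *)
Lemma sections_connect C en ns x s : is_walk x s ->
  sections_from (connecting_section C) en ns x s ->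
  exists h, connect (step G C) (x, en == Some true, has (mem C) ns) (walk_end x s, h, false).
Proof.
elim: s en ns x => [|[e y] s IH] en ns x /=.
  by move=> _ ->; rewrite andbF; exists (en == Some true); apply: connect0.
case/andP=> je w; case: ifP => le.
  move/(IH _ _ _ w) => [h c]; exists h; apply: connect_trans c; apply: connect1.
  rewrite has_rcons orbC; apply: step_lin; by apply/asboolP; exists e.
move=> [E] /(IH _ _ _ w) [h c]; exists h; apply: connect_trans c; apply: connect1.
rewrite /= orbF; apply: step_ed E; apply/asboolP; exists e; split=> //.
by rewrite le.
Qed.

Lemma connect_sections C en ns x y h :
  connect (step G C) (x, en == Some true, has (mem C) ns) (y, h, false) ->
  exists s, walk_between x y s /\ sections_from (connecting_section C) en ns x s.
Proof.
case/connectP=> p; elim: p en ns x => [|[[z h'] c'] p IH] en ns x /=.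
  move=> _ [-> _ nC]; exists [::]; split=> //=.
  by rewrite /connecting_section -nC andbF.
case/andP => /stepP [{}z l|{}z hx hy l cE] pp lst.
  case/asboolP: l => e le je.
  have [||s [[w we] S]] := IH en (rcons ns z) z; rewrite ?has_rcons 1?[_ || has _ _]orbC //.
  by exists ((e, z) :: s); rewrite /walk_between /= je w le.
case/asboolP: l => e [le je ex ey].
have [||s [[w we] S]] := IH (Some hy) [:: z] z; rewrite /= ?orbF; try by case: (hy) pp lst.
exists ((e, z) :: s); rewrite /walk_between /= je w (negbTE le) ex ey; split=> //; split=> //.
by rewrite /connecting_section cE; case: hx {ex cE}.
Qed.

Lemma connecting_connect C i j : no_dotted G ->
  (exists s, walk_between i j s /\ connecting C i s) <->
  exists h, connect (step G C) (i, false, i \in C) (j, h, false).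
Proof.
move=> nd; split.
  move=> [s [[w we] /(connectingP _ _ _ nd)/(sections_connect w) [h]]].
  by rewrite we /= orbF; exists h.
move=> [h c]; have := @connect_sections C None [:: i] i j h; rewrite /= orbF => /(_ c).
by move=> [s [w S]]; exists s; split=> //; apply/connectingP.
Qed.

Definition inducing_section en ns ex : Prop :=
  if (en, ex) is (Some a, Some b) then a && b else size ns = 1.

Lemma primitive_sectionsP i s : no_dotted G ->
  ((forall p q r, is_section s p q r ->
      ~ endpoint_section p r -> collider_section i p q r) /\
   (forall p q r, is_section s p q r ->
      endpoint_section p r -> size (section_nodes i p q) = 1))
  <-> sections_from inducing_section None [:: i] i s.
Proof.
move=> nd; apply: iff_trans (sectionsP _ _ _); split.
  move=> [H1 H2] p q r S; move: (H1 _ _ _ S) (H2 _ _ _ S) => {H1 H2 S}.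
  rewrite /endpoint_section; case: p => [|st p]; first by move=> _ E; apply: E; left.
  case: r => [|[f z] r]; first by move=> _ E; apply: E; right.
  move=> H _; have /(collider_sectionP _ _ _ _ nd) : collider_section i (st :: p) q ((f, z) :: r).
    by apply: H => -[].
  by rewrite /inducing_section => -[-> ->].
move=> H; split=> p q r /H; rewrite /endpoint_section.
  case: p => [|st p]; first by move=> _ []; left.
  case: r => [|[f z] r]; first by move=> _ []; right.
  by case/andP => E1 E2 _; apply/collider_sectionP => //=; rewrite E1 E2.
by case: p => [|st p]; case: r => [|[f z] r] // _ [].
Qed.

(** The first alternative is a walk already in its one-node end section. It is excluded after a
    line, when the section has at least two nodes; hence the last edge is not a line. *)
Lemma sections_inducing i j (a : bool) ns x s : 0 < size ns ->
  is_walk x s -> walk_end x s = j ->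
  sections_from inducing_section (Some a) ns x s ->
  (forall y, y \in belast x (later_nodes s) -> ant2 G i j y) ->
  s = [::] /\ size ns = 1 \/
  exists u h2, [/\ a, ant2 G i j u, connect (ind_step G i j) x u & ed G true h2 u j].
Proof.
elim: s a ns x => [|[e y] s IH] a ns x ns0 /=; first by left.
case/andP=> je w we S ant_s; right.
have ax : ant2 G i j x by apply: ant_s; rewrite inE eqxx.
have {}ant_s z : z \in belast y (later_nodes s) -> ant2 G i j z.
  by move=> zs; apply: ant_s; rewrite inE zs orbT.
case: ifP S => le S.
  have l : lin G x y by apply/asboolP; exists e.
  have ay : ant2 G i j y by apply: ant2_mono ax; apply: lin_ant; rewrite lin_sym.
  case: (IH _ (rcons ns y) _ _ w we S ant_s) => [|[_]|[u [h2 [aT au cu e2]]]].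
  - by rewrite size_rcons.
  - by rewrite size_rcons => -[] nsE; rewrite nsE in ns0.
  exists u, h2; split=> //; apply: connect_trans cu; apply: connect1.
  by rewrite /ind_step l ax ay.
case: S => /andP[aT hx] S.
have l : ed G true (head_at e y) x y by apply/asboolP; exists e; rewrite le.
case: s IH w we S ant_s => [|st s] IH w we S ant_s.
  by exists x, (head_at e y); split; rewrite // -[j]we.
have ay : ant2 G i j y by apply: ant_s; rewrite inE eqxx.
have [[]|[u [h2 [hT au cu e2]]]] := IH _ [:: y] _ isT w we S ant_s => //.
exists u, h2; split=> //; apply: connect_trans cu; apply: connect1.
by rewrite hT in l; rewrite /ind_step l ax ay orbT.
Qed.

Lemma primitive_inducing_inducing i j s : no_dotted G -> ~ adjacent G i j ->
  (forall x, Ant G [set i; j] x -> ant2 G i j x) ->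
  primitive_inducing i j s -> exists h1 h2, inducing G i j h1 h2.
Proof.
move=> nd nadj AE [nij [w we]] [|[H1 H2 H3]].
  case: s w we => [|[e y] [|? ?]] //=; rewrite andbT => je yj _.
  by case: nadj; exists e; rewrite -yj.
case: s w we H1 H2 H3 => [|[e y] s]; first by move=> _ ij; rewrite -ij eqxx in nij.
move=> /andP[je w] we H1 H2 H3.
have /= := (primitive_sectionsP i ((e, y) :: s) nd).1 (conj H1 H2).
case: ifP => le.
  (* A walk starting with a line has a first section of at least two nodes, contrary to the
     condition on endpoint sections. *)
  suff long : forall (ns : seq V) x s', 1 < size ns ->
      ~ sections_from inducing_section None ns x s'.
    by move/long; case.
  move=> ns x s'; elim: s' ns x => [|[f z] s' IH] ns x ns1 /=; first by move: ns1 => /[swap] ->.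
  by case: ifP => _; [apply: IH; rewrite size_rcons ltnW | case=> ns1'; rewrite ns1' in ns1].
move=> [_ S].
case: s w we H1 H2 H3 S => [|st s] w we _ _ H3 S.
  by case: nadj; exists e; rewrite -[j]we.
have ant_s x : x \in belast y (later_nodes (st :: s)) -> ant2 G i j x.
  by move=> xs; apply: AE; apply: H3.
have [[]|[u [h2 [hT au cu e2]]]] :=
  @sections_inducing i j (head_at e y) [:: y] y (st :: s) isT w we S ant_s => //.
exists (head_at e i), h2, y, u; split=> //.
  by apply/asboolP; exists e; rewrite le.
by rewrite au ant_s // inE eqxx.
Qed.

Lemma inducing_sections i j h2 ns x u :
  connect (ind_step G i j) x u -> ant2 G i j x -> ed G true h2 u j ->
  exists st s, [/\ is_walk x (st :: s), walk_end x (st :: s) = j,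
    sections_from inducing_section (Some true) ns x (st :: s)
    & forall y, y \in belast x (later_nodes (st :: s)) -> ant2 G i j y].
Proof.
case/connectP => p pp -> {u}; elim: p x ns pp => [|y p IH] x ns /=.
  move=> _ ax /asboolP [e [le je ex ey]]; exists (e, j), [::].
  rewrite /= je (negbTE le) ex; split=> // y; by rewrite inE => /eqP ->.
case/andP=> /and3P[l ax ay] pp _ e2; case/orP: l => /asboolP.
  move=> [e le je]; have [st [s [w we S ant_s]]] := IH _ (rcons ns y) pp ay e2.
  exists (e, y), (st :: s); split=> //; first by rewrite /= je; apply: w.
    by rewrite /= le; apply: S.
  by move=> z; rewrite inE => /orP[/eqP ->|] //; apply: ant_s.
move=> [e [le je ex ey]]; have [st [s [w we S ant_s]]] := IH _ [:: y] pp ay e2.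
exists (e, y), (st :: s); split=> //; first by rewrite /= je; apply: w.
  by rewrite /= (negbTE le) ex ey; split=> //; apply: S.
by move=> z; rewrite inE => /orP[/eqP ->|] //; apply: ant_s.
Qed.

Lemma inducing_primitive_inducing i j h1 h2 : no_dotted G -> i != j ->
  (forall x, ant2 G i j x -> Ant G [set i; j] x) ->
  inducing G i j h1 h2 -> exists s, primitive_inducing i j s.
Proof.
move=> nd nij AE [q [u [/asboolP [e [le je _ eq]] /andP[aq _] cq e2]]].
have [st [s [w we S ant_s]]] := inducing_sections [:: q] cq aq e2.
exists ((e, q) :: st :: s); split=> //; first by split=> //=; rewrite je; apply: w.
right; have [|H1 H2] := (primitive_sectionsP i ((e, q) :: st :: s) nd).2.
  by rewrite /= (negbTE le) eq; split=> //; apply: S.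
by split=> // x xs; apply/AE/ant_s.
Qed.

(** * Anterior walks and acyclicity *)

Lemma walk_ant x s : is_walk x s ->
  all (fun st => is_line st.1 || is_arrow st.1 && (tgt st.1 == st.2)) s ->
  connect (ant_step G) x (walk_end x s).
Proof.
elim: s x => [|[e y] s IH] x /=; first by rewrite connect0.
case/andP=> je w /andP[k /(IH _ w)]; apply: connect_trans.
case/orP: k => [le|/andP[ae /eqP ey]]; first by apply: lin_ant; apply/asboolP; exists e.
apply: ed_ant; apply/asboolP; exists e; split=> //.
- by rewrite /is_line; move: ae; rewrite /is_arrow; case: (kind e).
- rewrite /head_at ey (eq_sym y) (negbTE (joins_neq je)) andbF orbF.
  by rewrite /is_arc; move: ae; rewrite /is_arrow; case: (kind e).
- by rewrite /head_at ae ey eqxx orbT.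
Qed.

Lemma ant_walk x (l : seq V) : path (ant_step G) x l ->
  exists s, [/\ is_walk x s, later_nodes s = l
    & all (fun st => is_line st.1 || is_arrow st.1 && (tgt st.1 == st.2)) s].
Proof.
elim: l x => [|y l IH] x /=; first by exists [::].
case/andP=> xy /IH [s [w sp k]]; case/orP: xy => /asboolP.
  by move=> [e le je]; exists ((e, y) :: s); rewrite /= je w sp le.
move=> [e [_ je ex ey]]; exists ((e, y) :: s); rewrite /= je w sp k andbT; split=> //.
by move: ex ey; rewrite /head_at; case: (is_arc e) => //= _ ->; rewrite orbT.
Qed.

Lemma forward_walk s : no_dotted G ->
  all (fun st : edge G * V => is_line st.1 || is_arrow st.1 && (tgt st.1 == st.2)) s
  = semi_directed s || all_lines s.
Proof.
move=> nd; rewrite /semi_directed /all_lines; apply/idP/idP.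
  move=> k; case: (boolP (has _ s)) => [_|] /=; last first.
    rewrite -all_predC => na; move: (conj na k) => /andP; rewrite -all_predI.
    apply: sub_all => st /=; by case: (is_arrow _); rewrite ?orbF.
  rewrite -all_predI; apply/orP; left; apply: sub_all k => st /=.
  by rewrite /is_line /is_arrow /is_arc; case: (kind _).
case/orP=> [/and3P[_ na k]|]; last by apply: sub_all => st ->.
move: (conj na k) => /andP; rewrite -all_predI; apply: sub_all => st /=.
move: (nd st.1); rewrite /is_line /is_arrow /is_arc /is_dotted.
by case: (kind _).
Qed.

Lemma anteriorP x y : no_dotted G ->
  anterior G x y <-> x != y /\ connect (ant_step G) x y.
Proof.
move=> nd; split=> -[nxy].
  by move=> [s [[w we] k]]; split=> //; rewrite -we; apply: walk_ant; rewrite ?forward_walk.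
case/connectP=> l /ant_walk [s [w <- k]] yE; split=> //; exists s; split.
  by rewrite yE.
by rewrite -forward_walk.
Qed.

Lemma AntP i j x : no_dotted G -> Ant G [set i; j] x <-> ant2 G i j x.
Proof.
move=> nd; split.
  case=> [|[[y yA /(anteriorP _ _ nd) [_ xy]] _]].
    by rewrite !inE => /orP[]/eqP ->; rewrite /ant2 connect0 ?orbT.
  apply: ant2_mono xy _; move: yA.
  by rewrite !inE => /orP[]/eqP ->; rewrite /ant2 connect0 ?orbT.
have [xA|xA] := boolP (x \in [set i; j]); first by left.
move=> ax; right; split=> //.
move: (xA); rewrite !inE => /norP[xi xj].
by case/orP: ax => c; [exists i | exists j]; rewrite ?inE ?eqxx ?orbT //; apply/anteriorP.
Qed.

(** A return path without repeated nodes, closed by the arrow, would be a semi-directed cycle; it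
    has at least two edges as there are no loops. *)
Lemma CMG_acyclic x y : CMG G -> ed G false true x y -> ~ connect (ant_step G) y x.
Proof.
move=> [nd nc] /asboolP [e [_ je ex ey]] /connectP[l pl lx].
case/shortenP: pl lx => l' /ant_walk [s [w sl k]] ul _ lx; subst l'.
have /andP[ae ty] : is_arrow e && (tgt e == y).
  by move: ex ey; rewrite /head_at; case: (is_arc e) => //= _ ->.
apply: nc; exists x, ((e, y) :: s); split; first split=> //.
- by split; [rewrite /= je | rewrite [RHS]lx].
- by case: s lx {w k ul} => //= lx; have := joins_neq je; rewrite lx eqxx.
have := forward_walk ((e, y) :: s) nd; rewrite /= k ae ty orbT /=.
by move/esym/orP; case=> // /andP[]; move: ae; rewrite /is_arrow /is_line; case: (kind e).
Qed.
End Sections.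

(** * Adding an edge, and the equivalence *)

Section AddEdge.
Variables (V : finType) (G : graph V) (i j : V) (nij : i != j) (t : edge_kind).
Let H := add_edge G nij t.

Lemma no_dotted_add_edge : no_dotted G -> t <> Dotted -> no_dotted H.
Proof. by move=> nd td [e|] //=; [apply: nd | move: td; rewrite /is_dotted /=; case: t]. Qed.

Lemma lin_add_edge x y : lin G x y -> lin H x y.
Proof. by move/asboolP => [e le je]; apply/asboolP; exists (Some e). Qed.

Lemma ed_add_edge hx hy x y : ed G hx hy x y -> ed H hx hy x y.
Proof. by move/asboolP => [e E]; apply/asboolP; exists (Some e). Qed.

Lemma step_add_edge C : subrel (step G C) (step H C).
Proof.
move=> [[x h] c] [[y h'] c'] /stepP [{}y l|{}y hx hy l cE].
  exact/step_lin/lin_add_edge.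
exact: step_ed (ed_add_edge l) cE.
Qed.

Lemma lin_add_edge_inv x y : t <> Line -> lin H x y -> lin G x y.
Proof.
move=> tl /asboolP [[e|] le je]; first by apply/asboolP; exists e.
by move: tl le; rewrite /is_line /=; case: t.
Qed.

Lemma ed_add_edge_inv hx hy x y : ed H hx hy x y ->
  [\/ ed G hx hy x y,
      [/\ x = i, y = j, hx = @head_at V H None i & hy = @head_at V H None j] |
      [/\ x = j, y = i, hx = @head_at V H None j & hy = @head_at V H None i]].
Proof.
move/asboolP => [[e|] [le je <- <-]]; first by apply: Or31; apply/asboolP; exists e.
case/orP: je => /= /andP[/eqP <- /eqP <-]; first by apply: Or32.
by apply: Or33.
Qed.

Lemma simulates_step C s0 x h c y h' c' : t <> Line ->
  (forall h,
     (simulates G C s0 i h (h && @head_at V H None i) ->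
      simulates G C s0 j (@head_at V H None j) (j \in C)) /\
     (simulates G C s0 j h (h && @head_at V H None j) ->
      simulates G C s0 i (@head_at V H None i) (i \in C))) ->
  step H C (x, h, c) (y, h', c') -> simulates G C s0 x h c -> simulates G C s0 y h' c'.
Proof.
move=> tl sim /stepP [{}y l|{}y hx hy l cE].
  by apply: simulates_lin; apply: lin_add_edge_inv.
case: (ed_add_edge_inv l) cE => [{}l ->|[-> -> -> ->] ->|[-> -> -> ->] ->].
- exact: simulates_ed.
- by have [] := sim h.
- by have [] := sim h.
Qed.

(** Connecting walks of [G] survive in [H]. Conversely [simulates] is invariant along a connecting
    walk of [H], and at its end it gives a [tail_exit], that is, a connecting walk of [G]. *)
Lemma same_model_add_edge : no_dotted G -> t <> Dotted -> t <> Line ->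
  (forall C s0 h,
     (simulates G C s0 i h (h && @head_at V H None i) ->
      simulates G C s0 j (@head_at V H None j) (j \in C)) /\
     (simulates G C s0 j h (h && @head_at V H None j) ->
      simulates G C s0 i (@head_at V H None i) (i \in C))) ->
  same_model G H.
Proof.
move=> nd td tl sim; have ndH := no_dotted_add_edge nd td.
suff conn (C : {set V}) a b : a \notin C ->
    (exists s, walk_between a b s /\ @connecting V G C a s) <->
    (exists s, walk_between a b s /\ @connecting V H C a s).
  move=> A B C; split=> -[dAB dAC dBC sep]; split=> // -[a [b [s [aA bB w c]]]];
    apply: sep; exists a, b;
    have aC : a \notin C by rewrite (disjointFr dAC aA).
  - by case: ((conn _ _ b aC).2 (ex_intro _ s (conj w c))) => s' []; exists s'.
  - by case: ((conn _ _ b aC).1 (ex_intro _ s (conj w c))) => s' []; exists s'.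
move=> aC; rewrite !connecting_connect // (negbTE aC); split=> -[h].
  move=> cG; exists h; apply: connect_sub cG => u v uv.
  exact/connect1/step_add_edge.
suff inv l x h' c' : path (step H C) (x, h', c') l ->
    last (x, h', c') l = (b, h, false) -> simulates G C (a, false, false) x h' c' ->
    tail_exit G C (a, false, false) b.
  case/connectP=> l pl lst; apply: (inv l a false false) => //.
  by split; [exists false | right]; apply: connect0.
elim: l x h' c' => [|[[y h''] c''] l IH] x h' c' /=.
  by move=> _ [-> -> ->]; apply: simulates_tail.
case/andP=> st pl lst sx; apply: (IH _ _ _ pl lst).
exact: simulates_step (sim C _) st sx.
Qed.

End AddEdge.

(** The first edge is an arrow from [i] to [q], so acyclicity makes [q] anterior to [j]. A tail at
    [j] would be an arrow from [j] to [q'], whose anteriority to [i] or [j] closes a cycle. *)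
Lemma inducing_tail (V : finType) (G : graph V) i j h : CMG G ->
  inducing G i j false h -> connect (ant_step G) i j /\ h.
Proof.
move=> cG [q [q' [e1 /andP[aq aq'] _ e2]]].
have qj : connect (ant_step G) q j.
  by case/orP: aq => // /(CMG_acyclic cG e1).
have ij := connect_trans (ed_ant e1) qj; split=> //.
case: h e2 => //; rewrite ed_sym => e2.
case: (CMG_acyclic cG e2); case/orP: aq' => // q'i.
exact: connect_trans q'i ij.
Qed.

Lemma inducing_same_model (V : finType) (G : graph V) (i j : V) (nij : i != j) h :
  CMG G -> inducing G i j h true -> exists t, same_model G (add_edge G nij t).
Proof.
move=> cG; case: h => I.
  exists Arc; apply: same_model_add_edge => //; first exact: cG.1.
  move=> C s0 h; rewrite /head_at /= andbT; split; apply: simulates_arc => //.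
  exact: inducing_sym.
have [ij _] := inducing_tail cG I.
exists Arrow; apply: same_model_add_edge => //; first exact: cG.1.
move=> C s0 h; rewrite /head_at /= eqxx eq_sym (negbTE nij) andbT andbF; split.
  exact: simulates_arrow.
exact: simulates_arrow_back.
Qed.

Lemma section_nodes_sub (V : finType) (G : graph V) i (p q r : seq (edge G * V)) :
  {subset section_nodes i p q <= walk_nodes i (p ++ q ++ r)}.
Proof.
move=> x; rewrite /section_nodes /walk_nodes /later_nodes /unzip2 !map_cat -!cat_cons !mem_cat.
by rewrite inE => /orP[/eqP ->|->]; rewrite ?orbT // mem_last.
Qed.
Arguments section_nodes_sub {V G i p q} r.

Lemma add_edge_connecting (V : finType) (G : graph V) (i j : V) (nij : i != j) t (C : {set V}) :
  i \notin C -> j \notin C ->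
  @connecting V (add_edge G nij t) C i [:: (None, j)].
Proof.
move=> iC jC p q r [sE _ _ _]; split.
  (* A collider section has an edge on either side, but this walk has only one edge. *)
  move=> [p' [e [x [f [z [r' [pE rE _]]]]]]]; move/(congr1 size): sE.
  by rewrite pE rE /= !size_cat size_rcons /= addnS addSn addnS.
move=> _ x /(section_nodes_sub r); rewrite -sE.
by rewrite !inE => /orP[]/eqP ->.
Qed.

Theorem theorem3 (V : finType) (G : graph V) (hG : CMG G) :
  maximal G <->
  ~ exists (i j : V) (s : seq (edge G * V)),
      [/\ i != j, ~ adjacent G i j & primitive_inducing i j s].
Proof.
have nd := hG.1; split=> [mx [i [j [s [nij nadj ps]]]]|no i j nij t nadj same].
  have [|h1 [h2 I]] := primitive_inducing_inducing nd nadj _ ps.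
    by move=> x /(AntP _ _ _ nd).
  (* With a tail at [j] there is a head at [i], and the reversed walk is used. *)
  case: h2 I => I; first by have [t] := inducing_same_model nij hG I; apply: mx.
  have nji : j != i by rewrite eq_sym.
  have {}I := inducing_sym I; have [_ h1T] := inducing_tail hG I; rewrite h1T in I.
  have [t] := inducing_same_model nji hG I; apply: mx.
  by move/(@adjacent_sym _ G).
pose C := [set x | ant2 G i j x & x \notin [set i; j]].
have iC : i \notin C by rewrite !inE eqxx andbF.
have jC : j \notin C by rewrite !inE eqxx orbT andbF.
(* The new edge alone is a connecting walk given [C], so a separation in the enlarged graph is
   absurd; [same] reduces it to one in [G]. *)
suff [_ _ _] : independence_model (add_edge G nij t) [set i] [set j] C.
  apply; exists i, j, [:: (None, j)]; rewrite !inE; split=> //.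
    by rewrite /walk_between /= /joins /= !eqxx.
  exact: add_edge_connecting.
apply/same; split; rewrite ?disjoints1 //; first by rewrite inE.
move=> [a [b [s [/set1P -> /set1P -> w c]]]].
have [h] := (connecting_connect C i j nd).1 (ex_intro _ s (conj w c)).
rewrite (negbTE iC) => /(connecting_inducing nd nadj erefl nij) [h1 [h2 I]].
have [|s' ps] := inducing_primitive_inducing nd nij _ I.
  by move=> x /(AntP _ _ _ nd).
by apply: no; exists i, j, s'.
Qed.
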